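(* For all $d\ge2$ there exist a constant $C=C(d)>0$ and a map $h\colon \mathbb{Z}_2\wr\mathbb{Z}^d\to L_1$ such that for all $u,v\in\mathbb{Z}_2\wr\mathbb{Z}^d$, $$\|h(u)-h(v)\|_{L_1}\le C\,\tau(u,v),$$ and, whenever $\tau(u,v)\ge3$, $$\rho\big(\tau(u,v)\big)\le\|h(u)-h(v)\|_{L_1},\qquad\text{where } \rho(t)=\frac{t}{\log(t)\,(\log\log t)^2}.$$
   Context: Logarithms are base $2$. The lattice $\mathbb{Z}^d$ is regarded as a graph (the Cayley graph with respect to the standard generators) with its graph distance, i.e. the $\ell_1$-distance. The underlying set of the lamplighter group/graph $\mathbb{Z}_2\wr\mathbb{Z}^d$ is identified with the set of pairs $(A,x)$, where $A$ is a finite subset of $\mathbb{Z}^d$ and $x\in\mathbb{Z}^d$. The travelling salesman semi-metric is $\tau((A,x),(B,y))=\mathrm{tsp}(x,A\triangle B,y)$, where for $x,y\in\mathbb{Z}^d$ and finite $F\subset\mathbb{Z}^d$, $\mathrm{tsp}(x,F,y)$ is the least $n\ge0$ such that there is a walk $x=x_0,x_1,\dots,x_n=y$ in the graph $\mathbb{Z}^d$ (consecutive vertices adjacent) with $F\subset\{x_0,\dots,x_n\}$. *)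

(* Defs.v *)
From HB Require Import structures.
From mathcomp Require Import all_boot all_order all_algebra finmap.
From mathcomp Require Import all_classical all_reals all_analysis.

Set Implicit Arguments.
Unset Strict Implicit.
Unset Printing Implicit Defensive.

Import Order.TTheory GRing.Theory Num.Theory.
Import numFieldNormedType.Exports.

Local Open Scope ring_scope.

Notation lattice d := 'rV[int]_d.

Definition adj (d : nat) (x y : lattice d) : bool :=
  [exists i, (y == x + delta_mx 0 i) || (y == x - delta_mx 0 i)].

(* The walk is x :: p, so its length (number of steps) is size p. *)
Definition covering_walk (d : nat) (x : lattice d) (F : {fset lattice d})
    (y : lattice d) (p : seq (lattice d)) : Prop :=
  [/\ path (@adj d) x p, last x p = y & {subset F <= x :: p}].

Definition covering_walk_length (d : nat) (x : lattice d)
    (F : {fset lattice d}) (y : lattice d) : pred nat :=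
  fun n => `[< exists2 p, covering_walk x F y p & size p = n >].

Lemma walk_exists (d : nat) (x y : lattice d) :
  exists p, path (@adj d) x p /\ last x p = y.
Proof.
pose P (v : lattice d) := forall x, exists p, path (@adj d) x p /\ last x p = x + v.
have P0 : P 0 by move=> z; exists [::]; rewrite addr0.
have PD v w : P v -> P w -> P (v + w).
  move=> Pv Pw z; have [p [pp lp]] := Pv z; have [q [pq lq]] := Pw (z + v).
  by exists (p ++ q); rewrite cat_path last_cat pp lp pq lq addrA.
have Pe i (k : int) : P (k *: delta_mx 0 i).
  have Pn n s : (s == 1) || (s == -1) -> P ((s *+ n) *: delta_mx 0 i).
    move=> hs; elim: n => [|n IH]; first by rewrite mulr0n scale0r.
    rewrite mulrS scalerDl; apply: PD => // z.
    exists [:: z + s *: delta_mx 0 i]; rewrite /= andbT; split=> //.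
    apply/existsP; exists i.
    by case/orP: hs => /eqP ->; rewrite ?scaleN1r ?scale1r eqxx ?orbT.
  case: k => n.
    have -> : Posz n = 1 *+ n by rewrite -natz.
    exact: Pn.
  have -> : Negz n = (-1) *+ n.+1 by rewrite NegzE -natz mulNrn.
  by apply: Pn; rewrite eqxx orbT.
have Pyx : P (y - x) by rewrite [y - x]row_sum_delta; elim/big_ind: _.
by have [p [pp lp]] := Pyx x; exists p; rewrite lp subrKC.
Qed.

Lemma covering_walk_length_exists (d : nat) (x : lattice d)
    (F : {fset lattice d}) (y : lattice d) :
  exists n, covering_walk_length x F y n.
Proof.
suff [p hp] : exists p, covering_walk x F y p.
  by exists (size p); apply/asboolP; exists p.
have [p [pp lp sp]] : exists p,
    [/\ path (@adj d) x p, last x p = y & {subset (F : seq _) <= x :: p}].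
  elim: (F : seq _) x => [|a s IH] z.
    by have [p [? ?]] := walk_exists z y; exists p.
  have [p [pp lp]] := walk_exists z a; have [q [pq lq sq]] := IH a.
  exists (p ++ q); split; rewrite ?cat_path ?last_cat ?pp ?lp //.
  have az : a \in z :: p by rewrite -lp mem_last.
  move=> b; rewrite inE -cat_cons mem_cat => /predU1P[->|/sq]; first by rewrite az.
  by rewrite inE => /predU1P[->|->]; rewrite ?az ?orbT.
by exists p.
Qed.

Definition tsp (d : nat) (x : lattice d) (F : {fset lattice d})
    (y : lattice d) : nat :=
  ex_minn (covering_walk_length_exists x F y).

Definition lamplighter (d : nat) : Type := ({fset lattice d} * lattice d)%type.

Definition tau (d : nat) (u v : lamplighter d) : nat :=
  tsp u.2 ((u.1 `\` v.1) `|` (v.1 `\` u.1))%fset v.2.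

Definition lebesgue01 (R : realType) : {measure set measurableTypeR R -> \bar R} :=
  mrestr (@lebesgue_measure R) (measurable_itv `[0%R, 1%R]).

(* The Banach space L_1([0, 1]), as a space of almost-everywhere classes.  An
   element coerces to a representative, and the representatives are defined
   on all of R, the measure being supported on [0, 1]. *)
Definition L1 (R : realType) := LspaceType1 (lebesgue01 R).

Definition L1dist (R : realType) (f g : L1 R) : \bar R :=
  ('N[lebesgue01 R]_1[EFin \o (f \- g)%R])%E.

Definition log2 (R : realType) (t : R) : R := ln t / ln 2.

Definition rho (R : realType) (t : R) : R :=
  t / (log2 t * log2 (log2 t) ^+ 2).

(* Main.v *)
(* For a level j and a shift s < 2^j, cut Z^d into cubes of side 2^j by shifting
   the standard dyadic grid by s in every coordinate.  Each cube Q yields a state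
   map on lamplighter configurations: remember on which side of Q the lamplighter
   stands, and the lamps on the other side.  The embedding sends (A, x) to the
   indicators of all its states, those of level j with weight
   1 / (2^k (k + 1)^2), k = floor(log2 j), in an l_1-space that embeds into L_1.
   - Upper bound: two configurations get different states only if Q separates two
     consecutive vertices of the travelling salesman walk, and at each level an
     edge of Z^d is cut by at most one of the 2^j shifts; the weights are summable.
   - Lower bound: insert the sites to be visited one at a time.  If 2^j is the
     scale of the distance of a new site to the old ones, the tour lengthens by
     at most 2d(2^j - 1), while at every level i < j and for every shift one
     more cube is met, which amounts to 2^j - 1 new pairs (shift, cube).  As soon
     as a level has two cubes meeting the sites, all of them detect the
     difference.  Only levels up to log2(tau) are needed, where the weights are
     at least a constant times 1 / (log tau (log log tau)^2). *)
Require Import Defs.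
From HB Require Import structures.
From mathcomp Require Import all_boot all_order all_algebra finmap.
From mathcomp Require Import all_classical all_reals all_analysis.
From mathcomp Require Import measurable_realfun ring lra zify.

Set Implicit Arguments.
Unset Strict Implicit.

Import Order.TTheory GRing.Theory Num.Theory.
Import numFieldNormedType.Exports.

Local Open Scope classical_set_scope.
Local Open Scope ring_scope.

(** * Realising countable l_1 isometrically in L_1([0, 1]) *)

Lemma measurable_EFin_norm (R : realType)
    (f : measurableTypeR R -> measurableTypeR R) :
  measurable_fun setT f ->
  measurable_fun setT (abse \o (EFin \o f) : _ -> \bar R).
Proof.
move=> mf; apply: (@measurableT_comp _ _ _ _ _ _ (@abse R)) => //.
exact/measurable_EFinP.
Qed.

Lemma L1_of_fun (R : realType) (f : measurableTypeR R -> measurableTypeR R) :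
  measurable_fun setT f -> ('N[lebesgue01 R]_1[EFin \o f] < +oo)%E ->
  exists g : L1 R, {ae lebesgue01 R, forall x, (g : _ -> R) x = f x}.
Proof.
move=> mf Nf.
pose fm : {mfun measurableTypeR R >-> measurableTypeR R} :=
  HB.pack f (isMeasurableFun.Build _ _ _ _ f mf).
pose q : {mfun_ (lebesgue01 R), measurableTypeR R >-> measurableTypeR R} := (\pi fm)%qT.
have qf : {ae lebesgue01 R, forall x, (q : _ -> R) x = f x}.
  have : (repr q = fm %[mod {mfun_ (lebesgue01 R),
      measurableTypeR R >-> measurableTypeR R}])%qT by rewrite reprK.
  by move/eqP; rewrite eqmodE => /asboolP; apply: filterS => x; exact.
have Nq : finite_norm (lebesgue01 R) 1 q.
  rewrite /finite_norm; apply: le_lt_trans Nf; rewrite !Lnorm1.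
  rewrite le_eqVlt; apply/orP; left; apply/eqP; apply: ae_eq_integral => //.
  - by apply: measurable_EFin_norm; exact: measurable_funPT.
  - exact: measurable_EFin_norm.
  - by apply: filterS qf => x /= -> _.
pose g : L1 R := HB.pack q (isFinLebesgue.Build _ _ _ _ _ (lexx 1%E) q Nq).
by exists g.
Qed.

Section Blocks.
Variable R : realType.
Let T := measurableTypeR R.

(* The blocks partition the line, and meet [0, 1] in sets of positive measure. *)
Let block (n : nat) : set T :=
  (fun t : T => `|ln t| : T) @^-1` `[n%:R, n.+1%:R[%classic.

Let mblock n : measurable (block n).
Proof.
rewrite /block -[X in measurable X]setTI.
have mln : measurable_fun setT (fun t : T => `|ln t| : T).
  by apply: measurableT_comp => //; exact: measurable_ln.
by apply: mln => //; exact: measurable_itv.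
Qed.

Let blockP n t : block n t <-> Num.truncn `|ln t : R| = n.
Proof.
rewrite /block /= in_itv /=; split=> [/truncn_def//|<-].
exact: truncn_itv.
Qed.

Let fin_block n : lebesgue01 R (block n) \is a fin_num.
Proof.
rewrite ge0_fin_numE//; apply: (@le_lt_trans _ _ (lebesgue01 R setT)).
  by apply: le_measure; rewrite ?inE.
rewrite /lebesgue01 /= /mrestr setTI lebesgue_measure_itv /= lte_fin ltr01.
by rewrite -EFinB ltry.
Qed.

Let block_gt0 n : 0 < fine (lebesgue01 R (block n)).
Proof.
rewrite fine_gt0// -ge0_fin_numE// fin_block andbT.
(* [J] lies in [0, 1], and on it [|ln t| = - ln t] is between [n] and [n + 1]. *)
pose J : set T := `]expR (- n.+1%:R), expR (- n%:R)[%classic.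
apply: (@lt_le_trans _ _ (lebesgue_measure J)).
  rewrite lebesgue_measure_itv /= lte_fin ltr_expR ltrN2 ltr_nat ltnSn.
  by rewrite -EFinB lte_fin subr_gt0 ltr_expR ltrN2 ltr_nat.
rewrite /lebesgue01 /= /mrestr; apply: le_measure.
- by rewrite inE; exact: measurable_itv.
- by rewrite inE; apply: measurableI => //; exact: measurable_itv.
move=> t; rewrite /J /block /= !in_itv /= => /andP[at1 tb1].
have t0 : 0 < t by apply: lt_trans at1; exact: expR_gt0.
have t1 : t <= 1.
  by rewrite (le_trans (ltW tb1))// -expR0 ler_expR oppr_le0.
rewrite t1 (ltW t0); split=> //; rewrite ler0_norm ?ln_le0//.
rewrite lerNr ltrNl -ler_expR -ltr_expR lnK ?posrE//.
by rewrite at1 ltW.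
Qed.

(** Dividing by the measure of the block makes block [n] contribute exactly [|a n|] to the L_1
    norm. *)
Let bfun (a : nat -> R) (t : T) : T :=
  a (Num.truncn `|ln t|) / fine (lebesgue01 R (block (Num.truncn `|ln t|))).

Let bfunE a n t : block n t ->
  bfun a t = a n / fine (lebesgue01 R (block n)).
Proof. by move=> /blockP tn; rewrite /bfun tn. Qed.

Let cover_block : \bigcup_n block n = setT.
Proof.
by apply/seteqP; split=> // t _; exists (Num.truncn `|ln t : R|) => //; apply/blockP.
Qed.

Let mbfun a : measurable_fun setT (bfun a).
Proof.
rewrite -cover_block; apply/measurable_fun_bigcup => // n.
apply: (eq_measurable_fun (cst (a n / fine (lebesgue01 R (block n))))) => //.
by move=> t; rewrite inE => /bfunE ->.
Qed.

Let int_bfun a :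
  (\int[lebesgue01 R]_x `|bfun a x|%:E = \esum_(n in [set: nat]) `|a n|%:E)%E.
Proof.
rewrite -{1}cover_block ge0_integral_bigcup//=; last 2 first.
- rewrite cover_block; exact: measurable_EFin_norm (mbfun a).
- by move=> n m _ _ [t [/blockP <- /blockP]].
rewrite -nneseries_esumT//; apply: eq_eseriesr => n _.
rewrite (eq_integral (cst (`|a n| / fine (lebesgue01 R (block n)))%:E)); last first.
  move=> t; rewrite inE => /(bfunE a) tn.
  by rewrite /cst tn normrM (@gtr0_norm _ (fine _)^-1) ?invr_gt0 ?block_gt0.
rewrite (integral_cst _ (mblock n))// -[X in (_ * X)%E]fineK// -EFinM mulfVK//.
by rewrite gt_eqF.
Qed.

Lemma ell1_to_L1_nat (X : Type) (phi : X -> nat -> R) :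
  (forall u, \esum_(n in [set: nat]) `|phi u n|%:E < +oo)%E ->
  exists h : X -> L1 R, forall u v,
    L1dist (h u) (h v) = (\esum_(n in [set: nat]) `|phi u n - phi v n|%:E)%E.
Proof.
move=> sphi.
have /choice[h hP] : forall u, exists g : L1 R,
    {ae lebesgue01 R, forall x, (g : _ -> R) x = bfun (phi u) x}.
  move=> u; apply: L1_of_fun; first exact: mbfun.
  by rewrite Lnorm1 int_bfun.
exists h => u v; rewrite /L1dist Lnorm1 -(int_bfun (fun n => phi u n - phi v n)).
apply: ae_eq_integral => //.
- apply: measurable_EFin_norm.
  apply: measurable_funB.
  + exact: (@measurable_funPT _ _ _ _ (repr (LebesgueSpace.sort (h u)))).
  + exact: (@measurable_funPT _ _ _ _ (repr (LebesgueSpace.sort (h v)))).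
- exact: measurable_EFin_norm (mbfun _).
- have := hP v; have := hP u; apply: filterS2 => x /= -> -> _.
  by rewrite /bfun -mulrBl.
Qed.

End Blocks.

Lemma ell1_to_L1 (R : realType) (I : countType) (X : Type) (phi : X -> I -> R) :
  (forall u, \esum_(i in [set: I]) `|phi u i|%:E < +oo)%E ->
  exists h : X -> L1 R, forall u v,
    L1dist (h u) (h v) = (\esum_(i in [set: I]) `|phi u i - phi v i|%:E)%E.
Proof.
move=> sphi.
(* Naturals that code no index get coordinate 0, so sums are unchanged. *)
pose psi u n := if pickle_inv n is Some i then phi u i else 0.
have transfer (a : I -> R) : (\esum_(i in [set: I]) `|a i|%:E =
    \esum_(n in [set: nat])
      `|if @pickle_inv I n is Some i then a i else 0|%:E)%E.
  rewrite [RHS](esumID (range (@choice.pickle I))) ?setTI; last by [].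
  rewrite [X in (_ + X)%E]esum1 ?adde0; last first.
    move=> n /= nI; case E: (pickle_inv n) => [i|]; rewrite ?normr0//.
    by have := @pickle_invK I n; rewrite E /= => pin; case: nI; exists i.
  rewrite esum_image; last by move=> i j _ _; exact: pcan_inj pickleK_inv _ _.
  by apply: eq_esum => i _; rewrite pickleK_inv.
have [u|h hP] := @ell1_to_L1_nat R X psi; first by rewrite -transfer.
exists h => u v; rewrite hP transfer; apply: eq_esum => n _.
by rewrite /psi; case: pickle_inv => // ; rewrite subr0.
Qed.

Definition cell (d : nat) (j s : nat) (p : lattice d) : lattice d :=
  \row_i ((p 0%R i + s%:Z) %/ (2 ^ j)%N%:Z)%Z.

Lemma sum_cell_neq_adj (d j : nat) (x y : lattice d) : adj x y ->
  (\sum_(s < 2 ^ j) (cell j s x != cell j s y) <= 1)%N.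
Proof.
have main i (z : lattice d) :
    (\sum_(s < 2 ^ j) (cell j s z != cell j s (z + delta_mx 0%R i)) <= 1)%N.
  set n := (2 ^ j)%N; have n0 : (0 < n%:Z)%R by rewrite ltz_nat expn_gt0.
  (* Moving by e_i changes a floor exactly where it jumps, and over a period
     the jumps telescope to 1. *)
  pose c (s : nat) : int := ((z 0%R i + s%:Z) %/ n%:Z)%Z.
  rewrite -lez_nat; apply: (@le_trans _ _ (\sum_(0 <= s < n) (c s.+1 - c s))).
    rewrite big_mkord (big_morph Posz PoszD (erefl _)).
    apply: ler_sum => s _.
    have le_c : c s <= c s.+1 by apply: lez_pdiv2r; lia.
    case: eqP => [_|ne]; first by rewrite subr_ge0.
    suff : c s != c s.+1 by lia.
    apply/eqP => eqc; apply: ne; apply/rowP => k; rewrite !mxE eqxx /=.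
    case: (eqVneq k i) => [->|_]; last by rewrite addr0.
    by move: eqc; rewrite /c addrAC -addrA -[1]/(1%:Z) -PoszD addn1.
  rewrite telescope_sumr// /c addr0 divzDr ?dvdzz// divzz.
  by rewrite addrAC subrr add0r; lia.
case/existsP => i /orP[] /eqP ->; first exact: main.
have := main i (x - delta_mx 0 i); rewrite subrK.
by under eq_bigr do rewrite eq_sym.
Qed.

Lemma walk_coord_dist (d : nat) (x : lattice d) p i (a b : lattice d) :
  path (@adj d) x p -> a \in x :: p -> b \in x :: p ->
  (`|a 0%R i - b 0%R i| <= size p)%N.
Proof.
have triangle (u v w : int) m n :
  (`|u - v| <= m)%N -> (`|v - w| <= n)%N -> (`|u - w| <= m + n)%N by lia.
have step (u v : lattice d) : adj u v -> (`|u 0%R i - v 0%R i| <= 1)%N.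
  case/existsP => k /orP[] /eqP ->; rewrite !mxE eqxx /=;
    by case: (i == k) => /=; lia.
have from_start q : forall y c, path (@adj d) y q -> c \in y :: q ->
    (`|y 0%R i - c 0%R i| <= size q)%N.
  elim: q => [|z q IH] y c /=; first by rewrite inE => _ /eqP ->; rewrite subrr.
  case/andP => yz zq; rewrite inE => /predU1P[->|cz]; first by rewrite subrr.
  exact: triangle (step _ _ yz) (IH z c zq cz).
elim: p x => [|y p IH] x pp ax bx.
  by move: ax bx; rewrite !inE => /eqP -> /eqP ->; rewrite subrr.
have pp' := pp; case/andP: pp => xy py; move: ax; rewrite inE.
case/predU1P => [->|ay]; first exact: from_start.
move: bx; rewrite inE => /predU1P[->|yb]; last exact: leqW (IH y py ay yb).
by rewrite ssrint.IntDist.distnC; apply: (from_start _ _ _ pp'); rewrite inE ay orbT.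
Qed.

Lemma l1_walk (d : nat) (x y : lattice d) : exists p,
  [/\ path (@adj d) x p, last x p = y
    & size p = (\sum_i `|y 0%R i - x 0%R i|)%N].
Proof.
pose P (v : lattice d) (n : nat) :=
  forall x, exists p, [/\ path (@adj d) x p, last x p = x + v & size p = n].
have PD v m w n : P v m -> P w n -> P (v + w) (m + n)%N.
  move=> Pv Pw z; have [p [pp lp sp]] := Pv z; have [q [pq lq sq]] := Pw (z + v).
  exists (p ++ q); rewrite cat_path last_cat size_cat pp lp pq lq addrA.
  by rewrite sp sq.
have Pe i (k : int) : P (k *: delta_mx 0 i) `|k|%N.
  have Pn n s : (s == 1) || (s == -1) -> P ((s *+ n) *: delta_mx 0 i) n.
    move=> hs; elim: n => [|n IH].
      by rewrite mulr0n scale0r => z; exists [::]; rewrite addr0.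
    rewrite mulrS scalerDl; apply: (PD _ 1%N _ n) => // z.
    exists [:: z + s *: delta_mx 0 i]; rewrite /= andbT; split=> //.
    apply/existsP; exists i.
    by case/orP: hs => /eqP ->; rewrite ?scaleN1r ?scale1r eqxx ?orbT.
  case: k => n; first by have := Pn n 1 isT; rewrite natz.
  by have := Pn n.+1 (-1) isT; rewrite mulNrn natz -NegzE.
have Pyx : P (y - x) (\sum_i `|((y - x)%R : lattice d) 0%R i|)%N.
  rewrite [X in P X _]row_sum_delta; elim/big_ind2 : _ => //.
  by move=> z; exists [::]; rewrite addr0.
have [p [pp lp sp]] := Pyx x; exists p; rewrite lp subrKC; split=> //.
by rewrite sp; apply: eq_bigr => i _; rewrite !mxE.
Qed.

(** * Tour length bounded by cube counts *)

(** A substitute for sharing a cube of level [j] that does not depend on the shift: sup-distance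
    below [2 ^ j]. *)
Definition near_at (d j : nat) (p q : lattice d) : bool :=
  [forall i, `|p 0%R i - q 0%R i| < 2 ^ j]%N.

Lemma near_at_walk (d j : nat) (x y : lattice d) : near_at j y x ->
  exists p, [/\ path (@adj d) x p, last x p = y
    & size p <= d * (2 ^ j).-1]%N.
Proof.
move=> /forallP near; have [p [pp lp sp]] := l1_walk x y.
exists p; split=> //; rewrite sp -[d in (d * _)%N]card_ord -sum_nat_const.
by apply: leq_sum => i _; have := near i; lia.
Qed.

(** Equal floors confine each coordinate to one interval of length [2 ^ j]. Contrapositively, sites
    that are not near lie in different cubes for every shift. *)
Lemma near_at_cell (d j s : nat) (p q : lattice d) :
  cell j s p = cell j s q -> near_at j p q.
Proof.
move=> eqc; apply/forallP => i.
have := congr1 (fun M : lattice d => M 0 i) eqc; rewrite !mxE.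
set n := (2 ^ j)%N; have n0 : n%:Z != 0 by rewrite eqz_nat -lt0n expn_gt0.
have n1 : 0 < n%:Z by rewrite ltz_nat expn_gt0.
move=> E; have := divz_eq (p 0 i + s%:Z) n%:Z; have := divz_eq (q 0 i + s%:Z) n%:Z.
rewrite E; have := modz_ge0 (p 0 i + s%:Z) n0; have := modz_ge0 (q 0 i + s%:Z) n0.
have := ltz_pmod (p 0 i + s%:Z) n1; have := ltz_pmod (q 0 i + s%:Z) n1; lia.
Qed.

(* The nonempty list S has at least one cell at each level and shift, so the
   truncated predecessor counts the cells beyond the first. *)
Definition splitting (d M : nat) (S : seq (lattice d)) : nat :=
  \sum_(j < M) \sum_(s < 2 ^ j) (size (undup (map (cell j s) S))).-1.

Lemma splitting_cons (d M j : nat) (q : lattice d) (S : seq (lattice d)) :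
  (j <= M)%N -> S != [::] ->
  (forall i z, (i < j)%N -> z \in S -> ~~ near_at i q z) ->
  (splitting M S + (2 ^ j).-1 <= splitting M (q :: S))%N.
Proof.
move=> jM S0 far.
have -> : (2 ^ j).-1 = (\sum_(i < M) \sum_(s < 2 ^ i) (i < j))%N.
  under eq_bigr do rewrite sum_nat_const card_ord.
  rewrite predn_exp mul1n.
  rewrite -(big_mkord predT (fun i => 2 ^ i)%N) -(big_mkord predT (fun i => 2 ^ i * (i < j))%N).
  rewrite [RHS](big_cat_nat (leq0n j) jM) /= [X in (_ + X)%N]big_nat_cond.
  rewrite [X in (_ + X)%N]big1 ?addn0.
    by apply: eq_big_nat => i /andP[_ ->]; rewrite muln1.
  by move=> i /andP[/andP[ji _] _]; rewrite ltnNge ji muln0.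
rewrite /splitting -big_split /=; apply: leq_sum => i _.
rewrite -big_split /=; apply: leq_sum => s _.
have : (0 < size (undup (map (cell i s) S)))%N.
  case: S S0 {far} => // z S _; rewrite lt0n size_eq0.
  by apply/eqP => /undup_nil.
case: ifP => [/mapP[z zS cz]|_]; last by rewrite /=; case: (_ < j)%N; lia.
case: (ltnP i j) => [ij _|_]; last lia.
by have := far _ _ ij zS; rewrite (near_at_cell cz).
Qed.

(** At a visit of [z], splice in a detour to [q] and back. *)
Lemma covering_walk_insert (d j : nat) (x y z q : lattice d)
    (p S : seq (lattice d)) :
  path (@adj d) x p -> last x p = y -> {subset S <= x :: p} ->
  z \in S -> near_at j q z ->
  exists p', [/\ path (@adj d) x p', last x p' = y, {subset q :: S <= x :: p'}
    & size p' <= size p + 2 * (d * (2 ^ j).-1)]%N.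
Proof.
move=> pp lp sp zS near_qz.
have near_zq : near_at j z q.
  by apply/forallP => i; rewrite ssrint.IntDist.distnC; exact: (forallP near_qz).
have [a [pa la sa]] := near_at_walk near_qz.
have [b [pb lb sb]] := near_at_walk near_zq.
have zp := sp _ zS; case/splitPl: {p} zp pp lp sp => p1 p2 lp1; rewrite cat_path last_cat lp1.
move=> /andP[pp1 pp2] lp2 sp.
exists (p1 ++ a ++ b ++ p2); split.
- by rewrite !cat_path lp1 la lb pp1 pa pb.
- by rewrite !last_cat lp1 la lb.
- move=> c; rewrite inE => /predU1P[->|/sp].
    rewrite -cat_cons mem_cat mem_cat; have := mem_last z a; rewrite la inE.
    case/predU1P => [->|->]; last by rewrite !orbT.
    by rewrite -lp1 mem_last.
  by rewrite -!cat_cons !mem_cat => /orP[->//|->]; rewrite !orbT.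
- by rewrite !size_cat; lia.
Qed.

Lemma tsp_min (d : nat) (x y : lattice d) (F : {fset lattice d}) p :
  covering_walk x F y p -> (tsp x F y <= size p)%N.
Proof.
move=> cp; rewrite /tsp; case: ex_minnP => n _; apply.
by apply/asboolP; exists p.
Qed.

Lemma tsp_walk (d : nat) (x y : lattice d) (F : {fset lattice d}) :
  exists2 p, covering_walk x F y p & size p = tsp x F y.
Proof. by rewrite /tsp; case: ex_minnP => n /asboolP[p ? ?] _; exists p. Qed.

Lemma tsp_le_splitting (d M : nat) (x y : lattice d) (F : {fset lattice d}) :
  {in (F : seq _) ++ [:: y; x] &, forall a b, near_at M a b} ->
  (tsp x F y <= 2 * d * splitting M ((F : seq _) ++ [:: y; x]))%N.
Proof.
move=> near; pose S0 := (F : seq (lattice d)) ++ [:: y; x].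
(* [j] is the least level at which [q] is near a site of [S]: nearness at [j] bounds the detour,
   minimality yields new cubes at all lower levels, and the hypothesis gives [j <= M]. *)
have minimal q S : {subset q :: S <= S0} -> S != [::] -> exists j,
    [/\ (j <= M)%N, exists2 z, z \in S & near_at j q z
      & splitting M S + (2 ^ j).-1 <= splitting M (q :: S)]%N.
  move=> qS S0'; have ex_near : exists j, has (near_at j q) S.
    exists M; case: S qS S0' => // z S qS _ /=.
    by rewrite near// ?qS// !inE eqxx ?orbT.
  case: (ex_minnP ex_near) => j /hasP[z zS nz] jmin.
  have jM : (j <= M)%N.
    apply: jmin; apply/hasP; exists z => //; apply: near; apply: qS;
      by rewrite inE ?eqxx ?zS ?orbT.
  exists j; split=> //; first by exists z.
  apply: splitting_cons => // i w ij wS; apply/negP => niw.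
  by move: ij; rewrite ltnNge jmin//; apply/hasP; exists w.
have walks T : {subset T <= S0} -> exists p,
    [/\ path (@adj d) x p, last x p = y, {subset T ++ [:: y; x] <= x :: p}
      & size p <= 2 * d * splitting M (T ++ [:: y; x])]%N.
  elim: T => [_|q T IH qTS].
    (* The initial walk from [x] to [y] is one-way and costs at most half of what is allowed. *)
    have [||j [jM [z]]] := minimal y [:: x] => //.
      by move=> z; rewrite mem_cat => ->; rewrite orbT.
    rewrite inE => /eqP -> /near_at_walk[p [pp lp szp]] big.
    exists p; split=> //=; last first.
      apply: leq_trans szp _; rewrite -mulnA; apply: leq_trans (leq_pmull _ _) => //.
      by rewrite leq_mul2l (leq_trans (leq_addl _ _) big) orbT.
    by move=> w; rewrite !inE => /orP[]/eqP ->; rewrite ?eqxx// -in_cons -lp mem_last.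
  have [|p [pp lp sp szp]] := IH; first by move=> z zT; apply: qTS; rewrite inE zT orbT.
  have [||j [jM [z zS nz] big]] := minimal q (T ++ [:: y; x]).
  - move=> z; rewrite inE mem_cat => /or3P[/eqP ->|zT|zyx].
    + by apply: qTS; rewrite inE eqxx.
    + by apply: qTS; rewrite inE zT orbT.
    + by rewrite mem_cat zyx orbT.
  - by case: (T).
  have [p' [pp' lp' sp' szp']] := covering_walk_insert pp lp sp zS nz.
  exists p'; split=> //=; apply: leq_trans szp' _; rewrite mulnA.
  apply: (leq_trans (leq_add szp (leqnn _))).
  by rewrite -mulnDr leq_mul2l big orbT.
have [//|p [pp lp sp szp]] := walks (F : seq _).
  by move=> z; rewrite mem_cat => ->.
apply: leq_trans szp; apply: tsp_min; split=> // z zF.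
by apply: sp; rewrite mem_cat zF.
Qed.

Lemma near_at_of_tsp (d M : nat) (x y : lattice d) (F : {fset lattice d}) :
  (tsp x F y < 2 ^ M)%N ->
  {in (F : seq _) ++ [:: y; x] &, forall a b, near_at M a b}.
Proof.
have [p [pp lp sp] <-] := tsp_walk x y F => lt_p a b.
have sub c : c \in (F : seq _) ++ [:: y; x] -> c \in x :: p.
  rewrite mem_cat => /orP[/sp//|]; rewrite !inE => /orP[]/eqP ->.
    by rewrite -lp -in_cons mem_last.
  by rewrite eqxx.
move=> /sub ax /sub bx; apply/forallP => i.
exact: leq_ltn_trans (walk_coord_dist _ pp ax bx) lt_p.
Qed.

(** * Cube states *)

(** The state is unchanged when the lamp at the lamplighter's position is switched, and when the
    lamplighter moves without entering or leaving the cube. *)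
Definition cube_state (d j s : nat) (q : lattice d) (u : lamplighter d) :
    bool * {fset lattice d} :=
  (cell j s u.2 == q,
   [fset z in u.1 | (cell j s z == q) != (cell j s u.2 == q)]%fset).

Definition lampdiff (d : nat) (u v : lamplighter d) : {fset lattice d} :=
  ((u.1 `\` v.1) `|` (v.1 `\` u.1))%fset.

(* In this order the last two sites, between which the walk has to run, are the
   first ones to be inserted in tsp_le_splitting. *)
Definition sites (d : nat) (u v : lamplighter d) : seq (lattice d) :=
  (lampdiff u v : seq _) ++ [:: v.2; u.2].

(** A lamp that differs goes unnoticed only on the lamplighter's side, where lamps are forgotten.
    Hence the states differ exactly when the cube separates two sites. *)
Lemma cube_state_eqP (d j s : nat) (q : lattice d) (u v : lamplighter d) :
  cube_state j s q u = cube_state j s q v <->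
  {in sites u v, forall z, (cell j s z == q) = (cell j s u.2 == q)}.
Proof.
split=> [[side lamps] z|same].
  rewrite mem_cat => /orP[|]; last by rewrite !inE => /orP[]/eqP ->.
  move=> zF; have [//|zu] := eqVneq (cell j s z == q) (cell j s u.2 == q).
  have := congr1 (fun A : {fset lattice d} => z \in A) lamps.
  rewrite !inE -side zu !andbT /= => uv.
  by move: zF; rewrite !inE uv; case: (z \in v.1).
have side : (cell j s u.2 == q) = (cell j s v.2 == q).
  by rewrite [RHS]same// mem_cat !inE eqxx orbT.
rewrite /cube_state -side; congr pair; apply/fsetP => z; rewrite !inE /=.
case: eqP => [_|/eqP zu]; first by rewrite !andbF.
rewrite !andbT; have [//|uv] := eqVneq (z \in u.1) (z \in v.1).
have zF : z \in sites u v.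
  rewrite mem_cat; apply/orP; left; rewrite !inE.
  by move: uv; do 2 case: (z \in _).
by move: zu; rewrite same// eqxx.
Qed.

(** * Level weights and their comparison with [rho] *)

(** A version of [1 / (j (log j)^2)] that is constant on dyadic blocks. Since [trunc_log 2 0 = 0],
    levels 0 and 1 both have weight 1. *)
Definition level_weight (R : realType) (j : nat) : R :=
  (2 ^ trunc_log 2 j * (trunc_log 2 j).+1 ^ 2)%N%:R^-1.

Lemma level_weight_gt0 (R : realType) j : 0 < level_weight R j.
Proof. by rewrite invr_gt0 ltr0n muln_gt0 !expn_gt0. Qed.

Lemma level_weight_le (R : realType) j m : (j <= m)%N -> level_weight R m <= level_weight R j.
Proof.
move=> /(leq_trunc_log 2) le_log; rewrite lef_pV2 ?posrE ?ltr0n ?muln_gt0 ?expn_gt0//.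
by rewrite ler_nat leq_mul ?leq_pexp2l ?leq_exp2r.
Qed.

Lemma sum_level_weight_le (R : realType) N : \sum_(j < N) level_weight R j <= 3.
Proof.
(* Levels 0 and 1 contribute 2. For [k > 0] the levels from [2 ^ k] to [2 ^ k.+1 - 1] contribute
   [1 / (k + 1)^2], at most [1 / k - 1 / (k + 1)], which telescopes. *)
have dyadic K : \sum_(0 <= j < 2 ^ K.+1) level_weight R j <= 3 - K.+1%:R^-1.
  elim: K => [|K IH].
    rewrite expn1 big_ltn// big_nat1 /level_weight trunc_log0 trunc_log1.
    by rewrite !expn0 exp1n muln1 invr1; lra.
  rewrite (big_cat_nat _ (n := 2 ^ K.+1)) ?leq_pexp2l//=.
  have -> : \sum_(2 ^ K.+1 <= j < 2 ^ K.+2) level_weight R j = K.+2%:R ^- 2.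
    transitivity (\sum_(2 ^ K.+1 <= j < 2 ^ K.+2)
        ((2 ^ K.+1)%N%:R * K.+2%:R ^+ 2)^-1 : R).
      apply: eq_big_nat => j jK; rewrite /level_weight (trunc_log_eq _ jK)//.
      by rewrite natrM [(K.+2 ^ 2)%N%:R]natrX.
    rewrite sumr_const_nat (expnS 2 K.+1) mul2n -addnn addnK -[LHS]mulr_natr invfM mulrAC.
    by rewrite mulVf ?mul1r// pnatr_eq0 expn_eq0.
  apply: (le_trans (lerD IH (lexx _))).
  have a0 : 0 < K.+1%:R :> R by rewrite ltr0n.
  have -> : K.+2%:R = K.+1%:R + 1 :> R by rewrite -natr1.
  move: (K.+1%:R) a0 => a a0.
  suff : (a + 1) ^- 2 <= a^-1 - (a + 1)^-1 by lra.
  have -> : a^-1 - (a + 1)^-1 = (a * (a + 1))^-1 by field; lra.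
  by rewrite lef_pV2 ?posrE; nra.
apply: (@le_trans _ _ (\sum_(0 <= j < 2 ^ N.+1) level_weight R j)); last first.
  by apply: le_trans (dyadic N) _; rewrite lerBlDr lerDl invr_ge0.
rewrite -(big_mkord predT) [leRHS](big_cat_nat _ (n := N)) //=.
  by rewrite lerDl sumr_ge0// => j _; exact/ltW/level_weight_gt0.
by rewrite (leq_trans (leqnSn N))// ltnW// ltn_expl.
Qed.

Lemma log2_ge (R : realType) (n : nat) (t : R) :
  (2 ^ n)%N%:R <= t -> n%:R <= log2 t.
Proof.
move=> le_t; have t0 : 0 < t by apply: lt_le_trans le_t; rewrite ltr0n expn_gt0.
have ln2 : 0 < ln 2 :> R by apply: ln_gt0; lra.
rewrite /log2 ler_pdivlMr// mulr_natl -lnXn; last lra.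
by rewrite ler_ln ?posrE ?exprn_gt0 -?natrX.
Qed.

(** Gives [log2 3 >= 3/2] from 9 >= 8, and [log2 (3/2) >= 1/2] from 9/4 >= 2. *)
Lemma log2_ge_half (R : realType) (n : nat) (t : R) :
  0 < t -> (2 ^ n)%N%:R <= t ^+ 2 -> n%:R / 2 <= log2 t.
Proof.
move=> t0 /log2_ge; rewrite /log2 lnXn// -mulr_natr; lra.
Qed.

(** With [k] the iterated truncated logarithm, [2 ^ k <= log2 t] and [(k + 1) / 2 <= log2 (log2 t)];
    squaring the latter costs the factor 4. *)
Lemma rho_le_level_weight (R : realType) (t : nat) : (3 <= t)%N ->
  rho (t%:R : R) <= 4 * t%:R * level_weight R (trunc_log 2 t).
Proof.
move=> t3; set m := trunc_log 2 t; set k := trunc_log 2 m.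
have m1 : (0 < m)%N by rewrite trunc_log_gt0//; lia.
have logt : m%:R <= log2 (t%:R : R).
  by apply: log2_ge; rewrite ler_nat trunc_logP//; lia.
have logt' : 3 / 2 <= log2 (t%:R : R).
  apply: log2_ge_half; first by rewrite ltr0n; lia.
  by rewrite -natrX ler_nat (@leq_trans (3 ^ 2)%N)// leq_exp2r.
have le_k : (2 ^ k)%N%:R <= log2 (t%:R : R).
  by apply: le_trans logt; rewrite ler_nat trunc_logP.
have loglogt : k%:R <= log2 (log2 (t%:R : R)) by exact: log2_ge.
have loglogt' : 1 / 2 <= log2 (log2 (t%:R : R)).
  by apply: (@log2_ge_half _ 1); [lra|rewrite expn1 expr2; move: (log2 _) logt' => x x0; nra].
have half : k.+1%:R / 2 <= log2 (log2 (t%:R : R)).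
  case: (k) loglogt => [//|k']; rewrite -(natr1 k'.+1) -(natr1 k').
  have k0 : 0 <= k'%:R :> R by []. move=> le_k'; lra.
have a0 : 0 < (2 ^ k)%N%:R :> R by rewrite ltr0n expn_gt0.
have b0 : 0 < k.+1%:R :> R by rewrite ltr0n.
rewrite /rho /level_weight -/m -/k natrM [(k.+1 ^ 2)%N%:R]natrX.
rewrite -mulrA [leRHS]mulrCA ler_wpM2l// -[4 in leRHS]invrK -invfM.
rewrite lef_pV2 ?posrE; last 2 first.
- by rewrite mulr_gt0 ?exprn_gt0//; [lra|apply: lt_le_trans half; rewrite divr_gt0].
- by rewrite !mulr_gt0 ?invr_gt0 ?exprn_gt0.
have -> : 4^-1 * ((2 ^ k)%N%:R * k.+1%:R ^+ 2) = (2 ^ k)%N%:R * (k.+1%:R / 2) ^+ 2 :> R by field.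
apply: ler_pM => //.
have h0 : 0 <= k.+1%:R / 2 :> R by rewrite divr_ge0.
by rewrite ler_sqr ?nnegrE// (le_trans h0 half).
Qed.

(** * Cut coordinates and the two bounds on their distances *)

(** Compares an arbitrary finite sum with an explicit list [s] of its possible nonzero terms; [s]
    may have repetitions. *)
Lemma sum_uniq_le (R : realDomainType) (T : eqType) (r s : seq T) (f : T -> R) :
  uniq r -> (forall i, 0 <= f i) -> (forall i, i \in r -> f i != 0 -> i \in s) ->
  \sum_(i <- r) f i <= \sum_(i <- s) f i.
Proof.
move=> ur f0 rs; pose r' := [seq i <- r | f i != 0].
have -> : \sum_(i <- r) f i = \sum_(i <- r') f i.
  rewrite big_filter (bigID (fun i => f i != 0)) /= addrC big1 ?add0r// => i.
  by rewrite negbK => /eqP.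
have sub : {subset r' <= s} by move=> i; rewrite mem_filter => /andP[fi /rs]; apply.
have : uniq r' by rewrite filter_uniq.
elim: r' s {rs} sub => [|i r' IH] s sub /=.
  by rewrite big_nil sumr_ge0.
case/andP => ir' ur'.
have is_ : i \in s by apply: sub; rewrite inE eqxx.
rewrite big_cons (perm_big _ (perm_to_rem is_)) big_cons lerD2l; apply: IH => //.
move=> j jr'; have : j \in s by apply: sub; rewrite inE jr' orbT.
rewrite (perm_mem (perm_to_rem is_)) inE => /predU1P[ji|//].
by move: ir'; rewrite -ji jr'.
Qed.

(** All natural shifts are allowed, to keep a plain countable product; [cut_coord] vanishes for
    [s >= 2 ^ j]. *)
Definition cut_index (d : nat) : countType :=
  (nat * nat * lattice d * (bool * {fset lattice d}))%type.

Definition cut_coord (R : realType) (d : nat) (u : lamplighter d)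
    (i : cut_index d) : R :=
  let: (j, s, q, st) := i in
  level_weight R j * ((s < 2 ^ j)%N && (cube_state j s q u == st))%:R.

Lemma cut_coord_dist (R : realType) (d : nat) (u v : lamplighter d) j s q st :
  `|cut_coord R u (j, s, q, st) - cut_coord R v (j, s, q, st)| =
  level_weight R j *
    ((s < 2 ^ j)%N && ((cube_state j s q u == st) != (cube_state j s q v == st)))%:R.
Proof.
rewrite /cut_coord -mulrBr normrM gtr0_norm ?level_weight_gt0//; congr (_ * _).
by case: (_ < _)%N; do 2 case: (_ == st); rewrite /= ?subrr ?subr0 ?sub0r ?normrN ?normr0 ?normr1.
Qed.

(** The indices whose difference between [u] and [v] can be charged to the step from [a] to [b]. *)
Definition separates (d : nat) (u v : lamplighter d) (a b : lattice d)
    (i : cut_index d) : bool :=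
  let: (j, s, q, st) := i in
  [&& (s < 2 ^ j)%N, (cell j s a == q) != (cell j s b == q)
    & st \in [:: cube_state j s q u; cube_state j s q v]].

(** 12 = 3 * 2 * 2: total weight at most 3 with at most one separating shift per level, the cubes of
    [a] and [b], and the states of [u] and [v]. *)
Lemma sum_separates_le (R : realType) (d : nat) (u v : lamplighter d)
    (a b : lattice d) (r : seq (cut_index d)) : adj a b -> uniq r ->
  \sum_(i <- r) level_weight R i.1.1.1 * (separates u v a b i)%:R <= 12.
Proof.
(* [N] exceeds every level in [r], so [r3] contains all indices of [r] with a nonzero term. *)
move=> ab ur; pose N := (\max_(i <- r) i.1.1.1).+1.
pose r1 : seq (nat * nat) := [seq (j, s) | j <- index_iota 0 N, s <- index_iota 0 (2 ^ j)].
pose r2 : seq (nat * nat * lattice d) :=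
  [seq (js, q) | js <- r1, q <- [:: cell js.1 js.2 a; cell js.1 js.2 b]].
pose r3 : seq (cut_index d) := [seq (jsq, st) | jsq <- r2,
  st <- [:: cube_state jsq.1.1 jsq.1.2 jsq.2 u; cube_state jsq.1.1 jsq.1.2 jsq.2 v]].
have w0 j : 0 <= level_weight R j by exact/ltW/level_weight_gt0.
apply: (@le_trans _ _ (\sum_(i <- r3) level_weight R i.1.1.1 * (separates u v a b i)%:R)).
  apply: sum_uniq_le => // [i|[[[j s] q] st] ir]; first by rewrite mulr_ge0.
  rewrite mulf_eq0 negb_or pnatr_eq0 eqb0 negbK => /andP[_ /and3P[sj sep stuv]].
  apply/allpairsPdep; exists (j, s, q), st; split=> //.
  apply/allpairsPdep; exists (j, s), q; split=> //; last first.
    by rewrite !inE /=; move: sep; rewrite ![q == _]eq_sym; do 2 case: (_ == q).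
  apply/allpairsPdep; exists j, s; split=> //; rewrite mem_index_iota//=.
  by rewrite /N ltnS (bigD1_seq _ ir ur) /= leq_maxl.
rewrite !big_allpairs_dep /=.
apply: (@le_trans _ _ (\sum_(j <- index_iota 0 N) level_weight R j * 4)).
  apply: ler_sum => j _.
  apply: (@le_trans _ _ (\sum_(s <- index_iota 0 (2 ^ j))
      (level_weight R j * 4) * (cell j s a != cell j s b)%:R)).
    apply: ler_sum => s _; rewrite !big_cons !big_nil /= !inE !eqxx orbT !andbT !addr0.
    rewrite [cell j s b == cell j s a]eq_sym ![true == _]eq_sym !eqb_id orbT andbT.
    have wj := w0 j; case: (_ == _); case: (_ < _)%N => /=; lra.
  rewrite -mulr_sumr ler_piMr ?mulr_ge0//.
  rewrite big_mkord -natr_sum lern1.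
  exact: sum_cell_neq_adj.
rewrite -mulr_suml big_mkord.
have := sum_level_weight_le R N; lra.
Qed.

(** If no step crossed the boundary of the cube, all sites would be on the side of [u.2] and the
    states would agree. *)
Lemma cut_neq_separates (d : nat) (u v : lamplighter d) p j s q st :
  covering_walk u.2 (lampdiff u v) v.2 p -> (s < 2 ^ j)%N ->
  (cube_state j s q u == st) != (cube_state j s q v == st) ->
  has (fun e => separates u v e.1 e.2 (j, s, q, st)) (zip (u.2 :: p) p).
Proof.
case=> pp lp sp sj neq.
have st_in : st \in [:: cube_state j s q u; cube_state j s q v].
  by rewrite !inE; move: neq; rewrite ![_ == st]eq_sym; do 2 case: (st == _).
have neq_cut : cube_state j s q u <> cube_state j s q v.
  by move=> E; move: neq; rewrite E eqxx.
apply: contraT => /hasPn no_sep; case: neq_cut; apply/cube_state_eqP => z zS.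
have zp : z \in u.2 :: p.
  move: zS; rewrite mem_cat => /orP[/sp//|]; rewrite !inE => /orP[]/eqP ->.
    by rewrite -in_cons -lp mem_last.
  by rewrite eqxx.
have same x r : {in zip (x :: r) r, forall e, (cell j s e.1 == q) = (cell j s e.2 == q)} ->
    {in x :: r, forall z, (cell j s z == q) = (cell j s x == q)}.
  elim: r x => [|y r IH] x xr w; first by rewrite inE => /eqP ->.
  rewrite inE => /predU1P[->//|wr].
  rewrite [RHS](xr (x, y)) ?inE ?eqxx//; apply: IH wr => e er.
  by apply: xr; rewrite inE er orbT.
apply: same zp => e /no_sep; rewrite /separates sj st_in andbT /= negbK.
by move/eqP.
Qed.

Lemma sum_cut_coord_le (R : realType) (d : nat) (u v : lamplighter d)
    (r : seq (cut_index d)) : uniq r ->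
  \sum_(i <- r) `|cut_coord R u i - cut_coord R v i| <= 12 * (tau u v)%:R.
Proof.
move=> ur; have [p cp szp] := tsp_walk u.2 v.2 (lampdiff u v).
have [pp _ _] := cp; pose steps := zip (u.2 :: p) p.
have w0 j : 0 <= level_weight R j by exact/ltW/level_weight_gt0.
(* Each differing index is charged to a step of an optimal walk. *)
apply: (@le_trans _ _ (\sum_(i <- r) \sum_(e <- steps)
    level_weight R i.1.1.1 * (separates u v e.1 e.2 i)%:R)).
  apply: ler_sum => -[[[j s] q] st] _; rewrite cut_coord_dist -mulr_sumr /=.
  rewrite ler_wpM2l// -natr_sum ler_nat.
  case: andP => [[sj neq]|//]; have := cut_neq_separates cp sj neq.
  by case/hasP => e es /= sep; rewrite (big_rem _ es) /= sep.
rewrite exchange_big /= -[tau u v]/(tsp u.2 (lampdiff u v) v.2) -szp.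
have -> : 12 * (size p)%:R = \sum_(e <- steps) (12 : R).
  rewrite big_const_seq count_predT iter_addr_0 size_zip /=.
  by rewrite (minn_idPr (leqnSn _)) [LHS]mulr_natr.
have adj_steps : {in steps, forall e, adj e.1 e.2}.
  rewrite /steps; elim: (p) (u.2) pp => //= y p' IH x /andP[xy py] e.
  by rewrite inE => /predU1P[->//|]; exact: IH.
rewrite !big_seq; apply: ler_sum => e /adj_steps ae.
exact: sum_separates_le.
Qed.

Lemma sum_cut_coord_ge (R : realType) (d : nat) (u v : lamplighter d) (m : nat) :
  exists2 r : seq (cut_index d), uniq r &
  level_weight R m * (splitting m.+1 (sites u v))%:R <=
    \sum_(i <- r) `|cut_coord R u i - cut_coord R v i|.
Proof.
pose r1 : seq (nat * nat) := [seq (j, s) | j <- index_iota 0 m.+1, s <- index_iota 0 (2 ^ j)].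
pose r2 : seq (nat * nat * lattice d) :=
  [seq (js, q) | js <- r1, q <- undup (map (cell js.1 js.2) (sites u v))].
(* At a cube separating the sites, this coordinate is nonzero for [u] and 0 for [v]. *)
pose r3 : seq (cut_index d) := [seq (jsq, cube_state jsq.1.1 jsq.1.2 jsq.2 u) | jsq <- r2].
exists r3.
  rewrite map_inj_uniq; last by move=> x y [].
  apply: allpairs_uniq_dep => [|js _|[x1 x2] [y1 y2] _ _ [-> ->]//]; last exact: undup_uniq.
  apply: allpairs_uniq_dep => [|j _|[x1 x2] [y1 y2] _ _ [-> ->]//]; exact: iota_uniq.
rewrite big_map !big_allpairs_dep /= /splitting natr_sum mulr_sumr.
rewrite big_mkord; apply: ler_sum => j _.
rewrite big_mkord natr_sum mulr_sumr.
apply: ler_sum => s _.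
under eq_bigr do rewrite cut_coord_dist ltn_ord eqxx /=.
rewrite -mulr_sumr; apply: ler_pM => //; first exact/ltW/level_weight_gt0.
  by apply: level_weight_le; rewrite -ltnS.
rewrite -natr_sum ler_nat; set C := undup _.
(* A single cube counts 0 on the left. With two or more, each cube in [C] contains a site and misses
   another, so it detects the difference. *)
have [C1|C2] := leqP (size C) 1; first by rewrite (leq_trans _ (leq0n _))//; case: size C1 => [|[]].
apply: leq_trans (leq_pred _) _; rewrite -sum1_size big_seq [leqRHS]big_seq.
apply: leq_sum => q qC; rewrite lt0b; apply/negP => /eqP/esym/eqP/esym/cube_state_eqP same.
move: C2; rewrite ltnNge => /negP; apply.
have uq : cell j s u.2 = q.
  move: qC; rewrite mem_undup => /mapP[z zS qz].
  by have := same z zS; rewrite -qz eqxx => /esym/eqP.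
apply: (@uniq_leq_size _ C [:: q]); first exact: undup_uniq.
move=> c; rewrite mem_undup => /mapP[z zS ->]; rewrite inE same//.
by rewrite uq.
Qed.

(** * Passage to infinite sums and the conclusion *)

Lemma esum_le_seq (R : realType) (I : choiceType) (f : I -> R) (B : R) :
  (forall i, 0 <= f i) ->
  (forall r, uniq r -> \sum_(i <- r) f i <= B) ->
  (\esum_(i in [set: I]) (f i)%:E <= B%:E)%E.
Proof.
move=> f0 le_B; apply: ge_ereal_sup => _ [X [finX _] <-].
by rewrite fsbig_finite//= sumEFin lee_fin le_B.
Qed.

Lemma esum_ge_seq (R : realType) (I : choiceType) (f : I -> R) (r : seq I) :
  (forall i, 0 <= f i) -> uniq r ->
  ((\sum_(i <- r) f i)%:E <= \esum_(i in [set: I]) (f i)%:E)%E.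
Proof.
move=> f0 ur; apply: esum_ge; exists [set` r].
  by split=> //; exact: finite_seq.
by rewrite -fsbig_seq// sumEFin.
Qed.

Theorem theorem13 : forall (R : realType) (d : nat), (2 <= d)%N ->
  exists (C : R) (h : lamplighter d -> L1 R),
    0 < C /\
    forall u v : lamplighter d,
      (L1dist (h u) (h v) <= (C * (tau u v)%:R)%:E)%E /\
      ((3 <= tau u v)%N -> ((rho (tau u v)%:R)%:E <= L1dist (h u) (h v))%E).
Proof.
(* [8 d] is 4 from [rho_le_level_weight] times [2 d] from [tsp_le_splitting]. *)
move=> R d d2; pose K : R := 8 * d%:R.
have d0 : 0 < d%:R :> R by rewrite ltr0n; lia.
have K0 : 0 < K by rewrite mulr_gt0.
(* Coordinates relative to a base point: the states of a single configuration
   are not summable. *)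
pose phi (u : lamplighter d) i := K * (cut_coord R u i - cut_coord R (fset0, 0 : lattice d) i).
have phiB u v i : `|phi u i - phi v i| = K * `|cut_coord R u i - cut_coord R v i|.
  by rewrite -mulrBr normrM gtr0_norm// opprB addrA subrK.
have upper (u v : lamplighter d) r : uniq r ->
    \sum_(i <- r) K * `|cut_coord R u i - cut_coord R v i| <= 12 * K * (tau u v)%:R.
  move=> ur; rewrite -mulr_sumr [12 * K]mulrC -[leRHS]mulrA.
  by rewrite ler_wpM2l ?(ltW K0)// sum_cut_coord_le.
have [u|h hP] := @ell1_to_L1 R (cut_index d) _ phi.
  (* Summability is the upper bound against the base configuration. *)
  apply: le_lt_trans (ltry (12 * K * (tau u (fset0, 0))%:R)).
  apply: esum_le_seq => // r /(upper u (fset0, 0)); congr (_ <= _).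
  by apply: eq_bigr => i _; rewrite normrM gtr0_norm.
exists (12 * K), h; split=> [|u v]; first by rewrite mulr_gt0.
split=> [|t3]; rewrite hP.
  apply: esum_le_seq => // r /(upper u v); congr (_ <= _).
  by apply: eq_bigr => i _; rewrite phiB.
set m := trunc_log 2 (tau u v).
have [r ur le_r] := sum_cut_coord_ge R u v m.
apply: le_trans (esum_ge_seq (r := r) _ ur) => //; rewrite lee_fin.
under eq_bigr do rewrite phiB.
rewrite -mulr_sumr; apply: le_trans (ler_wpM2l (ltW K0) le_r).
apply: le_trans (rho_le_level_weight R t3) _; rewrite -/m.
(* Since [tau u v < 2 ^ m.+1], all sites are near each other at level [m.+1]. *)
have : (tau u v <= 2 * d * splitting m.+1 (sites u v))%N.
  by apply/tsp_le_splitting/near_at_of_tsp/trunc_log_ltn.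
rewrite -(ler_nat R) !natrM => le_tau.
have := ler_wpM2l (ltW (level_weight_gt0 R m)) le_tau; rewrite /K; lra.
Qed.
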